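(* Let $d$ be an integer, let $\alpha\in\mathbb{R}$, and let $a,t$ be the integers with $d=2a-t$ and $0\le t<2$. Then $G(\alpha;2,d,2)\neq\emptyset$ if and only if $d>2$ and $\frac{t}{2}<\alpha$.
   Context: Work on the projective line $\mathbb{P}^1$ over an algebraically closed field. A coherent system of type $(n,d,k)$ is a pair $(E,V)$ where $E$ is a vector bundle of rank $n$ and degree $d$ on $\mathbb{P}^1$ and $V\subset H^0(E)$ is a vector subspace of dimension $k$. For $\alpha\in\mathbb{R}$ its $\alpha$-slope is $\mu_\alpha(E,V)=\frac{d}{n}+\alpha\frac{k}{n}$. A coherent subsystem of $(E,V)$ is a coherent system $(E',V')$ with $E'$ a (nonzero) subbundle of $E$ and $V'\subset V\cap H^0(E')$; it is proper if $(E',V')\neq(E,V)$. $(E,V)$ is $\alpha$-stable if $\mu_\alpha(E',V')<\mu_\alpha(E,V)$ for every proper coherent subsystem $(E',V')$. $G(\alpha;n,d,k)$ denotes the moduli space of $\alpha$-stable coherent systems of type $(n,d,k)$ on $\mathbb{P}^1$. *)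

(* Defs.v *)
From HB Require Import structures.
From mathcomp Require Import all_boot all_order all_algebra.
From mathcomp Require Import classical_sets reals.

Set Implicit Arguments.
Unset Strict Implicit.
Unset Printing Implicit Defensive.

Import Order.TTheory GRing.Theory Num.Theory.
Local Open Scope classical_set_scope.
Local Open Scope ring_scope.

(* The projective line over k is glued from U0 = Spec k[x] and U1 = Spec k[y]
   along y = x^-1.  Every vector bundle on an affine line is trivial, so a
   bundle of rank n is given by a transition matrix g in GL_n(k[x, x^-1]).
   Vectors are rows: the local sections s0 in k[x]^n over U0 and s1 in k[y]^n
   over U1 agree on the overlap when s1 = s0 *m g in k(x)^n.  With these
   conventions O(d) has the 1 x 1 transition matrix x^-d. *)

Notation ratfun k := {fraction {poly k}}.

(* A polynomial seen as a function on U0, resp. on U1 (with 'X read as x^-1). *)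
Definition chart0 (k : closedFieldType) (p : {poly k}) : ratfun k :=
  tofrac p.
Definition chart1 (k : closedFieldType) (q : {poly k}) : ratfun k :=
  (map_poly (fun c : k => chart0 c%:P) q).[(chart0 'X)^-1].

Definition is_laurent (k : closedFieldType) (f : ratfun k) : Prop :=
  exists (p : {poly k}) (N : nat), f = chart0 p / chart0 'X ^+ N.

Record vbundle (k : closedFieldType) (n : nat) := VBundle {
  trans :> 'M[ratfun k]_n;
  trans_unit : trans \in unitmx;
  trans_laurent : forall i j, is_laurent (trans i j);
  transV_laurent : forall i j, is_laurent (invmx trans i j) }.

(* Order of vanishing at infinity: deg(denominator) - deg(numerator). *)
Definition ord_inf (k : closedFieldType) (f : ratfun k) : int :=
  let r : {ratio {poly k}} := generic_quotient.repr f in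
  (size r.2)%:Z - (size r.1)%:Z.

(* deg E = deg (det E).  The frame of det E over U0 is a rational section with
   neither zero nor pole on U0; in the frame over U1 it reads det g, so its
   divisor is ord_inf (det g) times the point at infinity. *)
Definition degree (k : closedFieldType) (n : nat) (E : vbundle k n) : int :=
  ord_inf (\det (trans E)).

(* A global section is recorded by its component s0 over U0, which determines
   its component s1 over U1. *)
Definition H0 (k : closedFieldType) (n : nat) (E : vbundle k n) :
    set 'rV[{poly k}]_n :=
  [set s0 | exists s1 : 'rV[{poly k}]_n,
     map_mx (@chart1 k) s1 = map_mx (@chart0 k) s0 *m trans E].

(* V is a k-linear subspace of dimension m: the image of an injective k-linear
   map from k^m. *)
Definition is_subspace_of_dim (k : closedFieldType) (n m : nat)
    (V : set 'rV[{poly k}]_n) : Prop :=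
  exists2 B : 'M[{poly k}]_(m, n),
    injective (fun c : 'rV[k]_m => map_mx polyC c *m B) &
    V = range (fun c : 'rV[k]_m => map_mx polyC c *m B).

Record coherent_system (k : closedFieldType) (n : nat) (d : int) (m : nat) :=
  CoherentSystem {
    bundle : vbundle k n;
    sections : set 'rV[{poly k}]_n;
    bundle_degree : degree bundle = d;
    sections_H0 : sections `<=` H0 bundle;
    sections_dim : is_subspace_of_dim m sections }.

(* (A0, A1) is a morphism E' -> E, given by s0 |-> s0 *m A0 over U0 and
   s1 |-> s1 *m A1 over U1. *)
Definition is_morphism (k : closedFieldType) (n' n : nat)
    (E' : vbundle k n') (E : vbundle k n)
    (A0 A1 : 'M[{poly k}]_(n', n)) : Prop :=
  map_mx (@chart0 k) A0 *m trans E = trans E' *m map_mx (@chart1 k) A1.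

(* E' is a subbundle of E via (A0, A1): a morphism that is injective on the
   fibre at every point. *)
Definition is_subbundle (k : closedFieldType) (n' n : nat)
    (E' : vbundle k n') (E : vbundle k n)
    (A0 A1 : 'M[{poly k}]_(n', n)) : Prop :=
  [/\ is_morphism E' E A0 A1,
      forall c : k, row_free (map_mx (horner_eval c) A0) &
      forall c : k, row_free (map_mx (horner_eval c) A1)].

Definition is_coherent_subsystem (k : closedFieldType)
    (n' : nat) (d' : int) (m' : nat) (n : nat) (d : int) (m : nat)
    (X' : coherent_system k n' d' m') (X : coherent_system k n d m)
    (A0 A1 : 'M[{poly k}]_(n', n)) : Prop :=
  [/\ (0 < n')%N,
      is_subbundle (bundle X') (bundle X) A0 A1 &
      mulmxr A0 @` sections X' `<=` sections X].

(* (E', V') = (E, V) as subobjects: E' -> E is surjective over both charts and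
   V' maps onto V. *)
Definition is_whole (k : closedFieldType)
    (n' : nat) (d' : int) (m' : nat) (n : nat) (d : int) (m : nat)
    (X' : coherent_system k n' d' m') (X : coherent_system k n d m)
    (A0 A1 : 'M[{poly k}]_(n', n)) : Prop :=
  [/\ range (mulmxr A0 : 'rV[{poly k}]_n' -> 'rV[{poly k}]_n) = setT,
      range (mulmxr A1 : 'rV[{poly k}]_n' -> 'rV[{poly k}]_n) = setT &
      mulmxr A0 @` sections X' = sections X].

Definition slope (R : realType) (alpha : R) (n : nat) (d : int) (m : nat) : R :=
  d%:~R / n%:R + alpha * (m%:R / n%:R).

Definition alpha_stable (k : closedFieldType) (R : realType) (alpha : R)
    (n : nat) (d : int) (m : nat) (X : coherent_system k n d m) : Prop :=
  forall (n' : nat) (d' : int) (m' : nat) (X' : coherent_system k n' d' m')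
         (A0 A1 : 'M[{poly k}]_(n', n)),
    is_coherent_subsystem X' X A0 A1 -> ~ is_whole X' X A0 A1 ->
    slope alpha n' d' m' < slope alpha n d m.

Definition isomorphic (k : closedFieldType) (n : nat) (d : int) (m : nat)
    (X Y : coherent_system k n d m) : Prop :=
  exists A0 A1 : 'M[{poly k}]_n,
    [/\ is_morphism (bundle X) (bundle Y) A0 A1,
        A0 \in unitmx, A1 \in unitmx &
        mulmxr A0 @` sections X = sections Y].

(* The closed points of G(alpha; n, d, m): isomorphism classes of alpha-stable
   coherent systems of type (n, d, m). *)
Definition moduli (k : closedFieldType) (R : realType) (alpha : R)
    (n : nat) (d : int) (m : nat) : set (set (coherent_system k n d m)) :=
  [set c | exists2 X : coherent_system k n d m,
     alpha_stable alpha X & c = [set Y | isomorphic X Y]].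
Arguments moduli k {R} alpha n d m.

(* Main.v *)
From HB Require Import structures.
Require Import Defs.
From mathcomp Require Import all_boot all_order all_algebra.
From mathcomp Require Import classical_sets reals.
From mathcomp Require Import zify lra.

Import Order.TTheory GRing.Theory Num.Theory.
Local Open Scope classical_set_scope.
Local Open Scope ring_scope.

Set Implicit Arguments.
Unset Strict Implicit.
Unset Printing Implicit Defensive.

(** Every bundle on the projective line splits ([splitting]): its transition
    matrix is diag(x^r_i) up to a change of frame over each chart, so that
    E = O(-r_0) + O(-r_1) with r_0 + r_1 = -d when E has rank 2 and degree d.
    This is obtained by row reducing the transition matrix over k[x]
    ([row_reduction]).

    Let (E, V) be alpha-stable of type (2, d, 2).  The larger summand L of E has
    degree at least a, the smallest integer that is at least d/2, and (L, 0) is a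
    coherent subsystem; hence a < d/2 + alpha, that is t/2 < alpha.  Moreover, a
    line subbundle that contains a nonzero section of V has degree e with
    e + alpha < d/2 + alpha, that is 2e < d ([section_line_degree_lt]).  When
    d <= 2 this fails ([stable_necessary]).  Either the smaller summand has
    degree at most 0, so that the sections in V have constant components along
    it; a nonzero one has component zero there, hence lies in the larger
    summand.  Or E = O(1) + O(1), where V is spanned by the two rows of a 2 x 2
    matrix of linear forms; the determinant vanishes somewhere on the projective
    line, so some nonzero section of V vanishes at a point, and a section of
    O(1) + O(1) with a zero is a multiple of a constant vector, hence lies in a
    subbundle O(1) ([linear_pencil_line]).

    Conversely let d > 2 and t/2 < alpha.  On O(a) + O(a - t) let V be spanned
    by (1, x) and (x^a, 1).  These sections are generically independent, so a line
    subbundle contains at most a line of V.  A line subbundle has degree at most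
    a < d/2 + alpha, and one that contains a nonzero section of V has degree e
    with 2e < d ([model_line_section_degree_lt]).  A rank 2 subbundle is E
    itself, where a proper subspace of V has smaller slope because alpha > 0. *)

(** * The two charts of the projective line *)

HB.instance Definition _ (k : closedFieldType) :=
  GRing.RMorphism.copy (@chart0 k) (@FracField.tofrac {poly k}).

Lemma chart0_eq0 (k : closedFieldType) (p : {poly k}) :
  (chart0 p == 0) = (p == 0).
Proof. exact: tofrac_eq0. Qed.

Lemma chart0_inj (k : closedFieldType) : injective (@chart0 k).
Proof.
by move=> p q /eqP; rewrite -subr_eq0 -rmorphB chart0_eq0 subr_eq0 => /eqP.
Qed.

Lemma chart0X_neq0 (k : closedFieldType) : chart0 ('X : {poly k}) != 0.
Proof. by rewrite chart0_eq0 polyX_eq0. Qed.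

Lemma chart1E (k : closedFieldType) (q : {poly k}) :
  chart1 q =
    horner_morph (fun c => mulrC (chart0 'X)^-1 ((@chart0 k \o polyC) c)) q.
Proof. by []. Qed.

Fact chart1_is_zmod_morphism (k : closedFieldType) : zmod_morphism (@chart1 k).
Proof. by move=> p q; rewrite !chart1E rmorphB. Qed.

Fact chart1_is_monoid_morphism (k : closedFieldType) :
  monoid_morphism (@chart1 k).
Proof. by split=> [|p q]; rewrite !chart1E ?rmorph1 ?rmorphM. Qed.

HB.instance Definition _ (k : closedFieldType) :=
  GRing.isZmodMorphism.Build {poly k} (ratfun k) (@chart1 k)
    (@chart1_is_zmod_morphism k).
HB.instance Definition _ (k : closedFieldType) :=
  GRing.isMonoidMorphism.Build {poly k} (ratfun k) (@chart1 k)
    (@chart1_is_monoid_morphism k).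

Lemma chart1C (k : closedFieldType) (c : k) : chart1 c%:P = chart0 c%:P.
Proof. by rewrite chart1E horner_morphC. Qed.

Lemma chart1X (k : closedFieldType) : chart1 ('X : {poly k}) = (chart0 'X)^-1.
Proof. by rewrite chart1E horner_morphX. Qed.

(** The polynomial x^N p(1/x), for p of degree at most N: multiplying by x^N is
    how a polynomial on one chart becomes a polynomial on the other. *)
Definition rev_poly (k : closedFieldType) (N : nat) (p : {poly k}) : {poly k} :=
  \poly_(i < N.+1) p`_(N - i).

Lemma size_rev_poly (k : closedFieldType) N (p : {poly k}) :
  (size (rev_poly N p) <= N.+1)%N.
Proof. exact: size_poly. Qed.

Lemma rev_polyK (k : closedFieldType) N (p : {poly k}) :
  (size p <= N.+1)%N -> rev_poly N (rev_poly N p) = p.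
Proof.
move=> sp; apply/polyP=> i; rewrite !coef_poly.
case: ltnP => [lti|lei]; last by rewrite nth_default // (leq_trans sp).
by rewrite ltnS leq_subr subKn.
Qed.

Lemma chart1_rev (k : closedFieldType) N (p : {poly k}) :
  (size p <= N.+1)%N -> chart1 (rev_poly N p) = chart0 p / chart0 'X ^+ N.
Proof.
move=> sp; have p_poly : p = \poly_(i < N.+1) p`_i.
  apply/polyP=> i; rewrite coef_poly; case: ltnP => // leNi.
  by rewrite nth_default // (leq_trans sp).
rewrite {2}p_poly /rev_poly !poly_def !rmorph_sum mulr_suml /=.
rewrite (reindex_inj rev_ord_inj); apply: eq_bigr => i _ /=.
rewrite subSS subKn -1?ltnS // -!mul_polyC !rmorphM !rmorphXn /= chart1C chart1X.
rewrite -mulrA; congr (_ * _).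
have Xi0 : chart0 ('X : {poly k}) ^+ i != 0 by rewrite expf_neq0 ?chart0X_neq0.
have leiN : (i <= N)%N by rewrite -ltnS.
have -> : chart0 'X ^+ N = chart0 ('X : {poly k}) ^+ (N - i) * chart0 'X ^+ i.
  by rewrite -exprD subnK.
by rewrite exprVn invfM mulrCA divff ?mulr1.
Qed.

Lemma rev_poly_neq0 (k : closedFieldType) (q : {poly k}) :
  q != 0 -> rev_poly (size q) q != 0.
Proof.
apply: contraNneq => rev0; rewrite -(rev_polyK (leqnSn (size q))) rev0.
by apply/eqP/polyP=> i; rewrite coef_poly coef0 if_same coef0.
Qed.

Lemma chart1_eq0 (k : closedFieldType) (q : {poly k}) :
  (chart1 q == 0) = (q == 0).
Proof.
apply/idP/eqP=> [|->]; last by rewrite rmorph0.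
rewrite -{1}(rev_polyK (leqnSn (size q))) chart1_rev ?size_rev_poly //.
rewrite mulf_eq0 invr_eq0 expf_eq0 (negPf (chart0X_neq0 k)) andbF orbF chart0_eq0.
by apply: contraTeq => /rev_poly_neq0.
Qed.

Lemma chart1_inj (k : closedFieldType) : injective (@chart1 k).
Proof.
by move=> p q /eqP; rewrite -subr_eq0 -rmorphB chart1_eq0 subr_eq0 => /eqP.
Qed.

(** * The valuation at infinity *)

Lemma chart0_repr (k : closedFieldType) (f : ratfun k) :
  let r : {ratio {poly k}} := generic_quotient.repr f in
  chart0 r.1 = f * chart0 r.2.
Proof.
move=> r; rewrite -[f in RHS]generic_quotient.reprK -/r /chart0.
rewrite /FracField.tofrac; unlock.
rewrite -[RHS]FracField.pi_mul; apply/eqP; rewrite FracField.equivf_def.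
rewrite /FracField.mulf /= !numden_Ratio ?mulr1 ?oner_neq0 ?denom_ratioP //.
by rewrite mul1r mulrC.
Qed.

(* Unification would otherwise compare the charts by unfolding the quotient
   that defines the field of fractions. *)
Opaque chart0 chart1.

(** The order at infinity is read on a chosen representative; equality of
    fractions is equality of cross products, so any representative gives the
    same difference of degrees. *)
Lemma ord_inf_frac (k : closedFieldType) (p q : {poly k}) :
  p != 0 -> q != 0 ->
  ord_inf (chart0 p / chart0 q) = (size q)%:Z - (size p)%:Z.
Proof.
move=> p0 q0; rewrite /ord_inf; set f := chart0 p / chart0 q.
set r := generic_quotient.repr f.
have rd0 : r.2 != 0 by apply: denom_ratioP.
have e : r.1 * q = p * r.2.
  apply: chart0_inj; rewrite !rmorphM /= chart0_repr /f mulrAC.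
  by rewrite divfK ?chart0_eq0.
move: (r.1 : {poly k}) (r.2 : {poly k}) rd0 e => n d d0 e.
have n0 : n != 0.
  by apply: contraTneq (mulf_neq0 p0 d0) => n0; rewrite -e n0 mul0r eqxx.
have e_size : (size n + size q = size p + size d)%N.
  have /= := congr1 (fun u : {poly k} => (size u).+1) e.
  by rewrite !size_mul // !prednK // addn_gt0 size_poly_gt0 ?n0 ?p0.
change ((size d)%:Z - (size n)%:Z = (size q)%:Z - (size p)%:Z).
by move: (size p) (size q) (size n) (size d) e_size; lia.
Qed.

Lemma fracP (k : closedFieldType) (f : ratfun k) :
  exists p q : {poly k}, q != 0 /\ f = chart0 p / chart0 q.
Proof.
set r : {ratio {poly k}} := generic_quotient.repr f.
have rd0 : r.2 != 0 by apply: denom_ratioP.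
by exists r.1, r.2; split=> //; rewrite chart0_repr mulfK ?chart0_eq0.
Qed.

Lemma ord_infM (k : closedFieldType) (f g : ratfun k) :
  f != 0 -> g != 0 -> ord_inf (f * g) = ord_inf f + ord_inf g.
Proof.
have [p [q [q0 ->]]] := fracP f; have [p' [q' [q'0 ->]]] := fracP g.
rewrite !mulf_eq0 !invr_eq0 !chart0_eq0 (negPf q0) (negPf q'0) !orbF => p0 p'0.
rewrite mulf_div -!rmorphM !ord_inf_frac ?mulf_neq0 // !size_mul //.
rewrite (polySpred p0) (polySpred q0) (polySpred p'0) (polySpred q'0).
by rewrite !addnS /=; lia.
Qed.

Lemma ord_inf_chart0 (k : closedFieldType) (p : {poly k}) :
  p != 0 -> ord_inf (chart0 p) = 1 - (size p)%:Z.
Proof.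
move=> p0; have := ord_inf_frac p0 (oner_neq0 _).
by rewrite rmorph1 divr1 size_poly1.
Qed.

Lemma ord_infV (k : closedFieldType) (f : ratfun k) :
  f != 0 -> ord_inf f^-1 = - ord_inf f.
Proof.
move=> f0; have fV0 : f^-1 != 0 by rewrite invr_eq0.
have ord1 : ord_inf (1 : ratfun k) = 0.
  have <- : chart0 (1 : {poly k}) = 1 := rmorph1 _.
  by rewrite ord_inf_chart0 ?oner_neq0 // size_poly1.
have := ord_infM fV0 f0; rewrite (mulVf f0) ord1 => /esym/eqP.
by rewrite addr_eq0 => /eqP.
Qed.

Lemma ord_infXz (k : closedFieldType) (e : int) :
  ord_inf (chart0 ('X : {poly k}) ^ e) = - e.
Proof.
have ordXn n : ord_inf (chart0 ('X : {poly k}) ^+ n) = - n%:Z.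
  rewrite -rmorphXn ord_inf_chart0 ?expf_neq0 ?polyX_eq0 //.
  by rewrite size_polyXn; lia.
case: e => n; first exact: ordXn.
by rewrite NegzE -exprnN ord_infV ?expf_neq0 ?chart0X_neq0 // ordXn.
Qed.

(** A function that is regular on U1 has no pole at infinity. *)
Lemma ord_inf_chart1 (k : closedFieldType) (q : {poly k}) :
  q != 0 -> 0 <= ord_inf (chart1 q).
Proof.
move=> q0; have rev0 := rev_poly_neq0 q0.
have size_rev := size_rev_poly (size q) q.
rewrite -(rev_polyK (leqnSn (size q))) chart1_rev // -rmorphXn.
rewrite ord_inf_frac ?expf_neq0 ?polyX_eq0 //.
by rewrite size_polyXn; lia.
Qed.

Lemma size_le_of_chart1 (k : closedFieldType) (p q : {poly k}) (e : int) :
  chart0 p * chart0 'X ^ e = chart1 q -> p != 0 -> (size p)%:Z <= 1 - e.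
Proof.
move=> pq p0; have X0 := chart0X_neq0 k.
have q0 : q != 0.
  by rewrite -chart1_eq0 -pq mulf_neq0 ?chart0_eq0 ?(expfz_neq0 _ X0).
have := ord_inf_chart1 q0.
rewrite -pq ord_infM ?chart0_eq0 ?(expfz_neq0 _ X0) // (ord_inf_chart0 p0).
by rewrite ord_infXz; lia.
Qed.

(** * Laurent polynomials and determinants of transition matrices *)

Lemma mxlaurentP (k : closedFieldType) m n (A : 'M[ratfun k]_(m, n)) :
  (forall i j, is_laurent (A i j)) ->
  exists (N : nat) (B : 'M[{poly k}]_(m, n)),
    map_mx (@chart0 k) B = chart0 'X ^+ N *: A.
Proof.
move=> A_laurent.
have [p A_p] := fin_all_exists (fun i => fin_all_exists (A_laurent i)).
have [N A_pN] := fin_all_exists (fun i => fin_all_exists (A_p i)).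
pose M := (\max_(ij : 'I_m * 'I_n) N ij.1 ij.2)%N.
exists M, (\matrix_(i, j) (p i j * 'X ^+ (M - N i j))).
apply/matrixP=> i j; rewrite !mxE A_pN rmorphM rmorphXn /=.
have leNM : (N i j <= M)%N.
  exact: (@leq_bigmax _ (fun ij => N ij.1 ij.2) (i, j)).
have -> : chart0 'X ^+ M =
    chart0 ('X : {poly k}) ^+ (M - N i j) * chart0 'X ^+ N i j.
  by rewrite -exprD subnK.
rewrite mulrCA -mulrA mulfV ?mulr1 //.
by rewrite expf_neq0 ?chart0X_neq0.
Qed.

Lemma dvd_Xn (F : fieldType) (p : {poly F}) n :
  p %| 'X^n -> exists2 c : F, c != 0 & exists i, p = c *: 'X^i.
Proof.
rewrite -(subr0 'X) -polyC0 => /dvdp_exp_XsubCP [i _].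
rewrite polyC0 subr0 => /eqpf_eq [c c0 ->].
by exists c => //; exists i.
Qed.

(** The units of k[x, x^-1] are the monomials: if p and q are f and f^-1 with
    denominators cleared, then p divides a power of x. *)
Lemma laurent_unit (k : closedFieldType) (f : ratfun k) (p q : {poly k}) M N :
  chart0 p = chart0 'X ^+ M * f -> chart0 q = chart0 'X ^+ N * f^-1 -> f != 0 ->
  exists2 c : k, c != 0 & f = chart0 c%:P * chart0 'X ^ (- ord_inf f).
Proof.
move=> pf qf f0; have X0 := chart0X_neq0 k.
have /dvd_Xn [c c0 [i p_cXi]] : p %| 'X^(M + N).
  apply/dvdpP; exists q; apply: chart0_inj.
  by rewrite !rmorphM /= pf qf rmorphXn exprD mulrACA (mulVf f0) mulr1 mulrC.
have fE : f = chart0 c%:P * chart0 'X ^ (i%:Z - M%:Z).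
  apply: (mulfI (expf_neq0 M X0)).
  rewrite -pf p_cXi -mul_polyC rmorphM rmorphXn /= mulrCA; congr (_ * _).
  by rewrite expfzDr // -exprnN mulrCA mulfV ?expf_neq0 // mulr1.
exists c => //; rewrite {2}fE.
rewrite ord_infM ?expfz_neq0 ?chart0_eq0 ?polyC_eq0 ?polyX_eq0 //.
rewrite ord_infXz ord_inf_chart0 ?polyC_eq0 // size_polyC c0 subrr add0r opprK.
exact: fE.
Qed.

Lemma det_trans (k : closedFieldType) n (E : vbundle k n) :
  exists2 c : k, c != 0 &
    \det (trans E) = chart0 c%:P * chart0 'X ^ (- degree E).
Proof.
have [M [A AE]] := mxlaurentP (@trans_laurent _ _ E).
have [N [B BE]] := mxlaurentP (@transV_laurent _ _ E).
apply: (@laurent_unit _ _ (\det A) (\det B) (M * n) (N * n)).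
- by rewrite -det_map_mx AE detZ exprM.
- by rewrite -det_map_mx BE detZ exprM det_inv.
- by have := trans_unit E; rewrite unitmxE unitfE.
Qed.

Lemma det_trans_neq0 (k : closedFieldType) n (E : vbundle k n) :
  \det (trans E) != 0.
Proof. by have := trans_unit E; rewrite unitmxE unitfE. Qed.

(** * Matrices of polynomials *)

Lemma det_mx2 (A : comNzRingType) (M : 'M[A]_2) :
  \det M = M 0 0 * M 1 1 - M 0 1 * M 1 0.
Proof.
rewrite (expand_det_row _ 0) !big_ord_recl big_ord0 /cofactor !det_mx11 !mxE.
rewrite /= expr0 expr1 mul1r mulN1r addr0 mulrN.
by congr (M _ _ * M _ _ - M _ _ * M _ _); apply: val_inj.
Qed.

Lemma ord2P (i : 'I_2) : i = 0 \/ i = 1.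
Proof.
by case: i => [[|[|//]]] lt_i; [left|right]; apply: val_inj.
Qed.

Lemma left_kernel (F : fieldType) m n (A : 'M[F]_(m, n)) :
  (n < m)%N -> exists2 c : 'rV[F]_m, c != 0 & c *m A = 0.
Proof.
move=> lt_nm; have /rowV0Pn [c c_ker c0] : kermx A != 0.
  by rewrite kermx_eq0 /row_free neq_ltn (leq_ltn_trans (rank_leq_col A)).
by exists c => //; apply/sub_kermxP.
Qed.

Lemma unitmx_polyP (F : fieldType) n (A : 'M[{poly F}]_n) :
  A \in unitmx <-> exists2 c, c != 0 & \det A = c%:P.
Proof.
rewrite unitmxE poly_unitE; split=> [/andP [/size_poly1P //]|[c c0 ->]].
by rewrite size_polyC c0 coefC unitfE.
Qed.

Lemma unitmx_horner (F : fieldType) n (P : 'M[{poly F}]_n) (c : F) :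
  P \in unitmx -> map_mx (horner_eval c) P \in unitmx.
Proof.
move=> /unitmx_polyP [b b0 detP].
by rewrite unitmxE det_map_mx detP unitfE /= /horner_eval hornerC.
Qed.

Lemma poly_eq0_of_horner (k : closedFieldType) (p : {poly k}) :
  (forall c, p.[c] = 0) -> p = 0.
Proof.
(* A nonconstant 1 + p would have a root, at which p takes the value -1. *)
move=> p0; have [/size_poly1P [b b0 pb]|/closed_rootP [z]] :=
  boolP (size (1 + p) == 1%N).
  have pE : p = (b - 1)%:P by rewrite rmorphB /= -pb addrC addKr.
  by have := p0 0; rewrite pE hornerC => ->.
by rewrite rootE hornerD p0 hornerC addr0 oner_eq0.
Qed.

Lemma fibrewise_free_inj (k : closedFieldType) m n (A : 'M[{poly k}]_(m, n)) :
  (forall c, row_free (map_mx (horner_eval c) A)) ->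
  forall u : 'rV_m, u *m A = 0 -> u = 0.
Proof.
move=> A_free u uA; apply/rowP=> i; rewrite [RHS]mxE.
apply: poly_eq0_of_horner => c.
have : map_mx (horner_eval c) u *m map_mx (horner_eval c) A = 0.
  by rewrite -map_mxM uA map_mx0.
rewrite -(mul0mx _ (map_mx (horner_eval c) A)) => /(row_free_inj (A_free c)).
by move/rowP => /(_ i); rewrite !mxE.
Qed.

Lemma fibrewise_free_unitmx (k : closedFieldType) n (A : 'M[{poly k}]_n) :
  (forall c, row_free (map_mx (horner_eval c) A)) -> A \in unitmx.
Proof.
move=> A_free; apply/unitmx_polyP/size_poly1P.
apply: contraT => /closed_rootP [z]; rewrite rootE.
have := A_free z; rewrite row_free_unit unitmxE unitfE det_map_mx /= /horner_eval.
by move/negPf ->.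
Qed.

(** Replacing row i of a matrix by a combination of its rows is invertible as
    soon as row i enters the combination with a nonzero scalar: the matrix of
    this operation is 1 + e w with w e = c - 1, and its inverse is
    1 - c^-1 e w. *)
Lemma unitmx_replace_row (F : fieldType) n (i : 'I_n) (v : 'rV[{poly F}]_n)
    (c : F) :
  c != 0 -> v 0 i = c%:P ->
  1%:M + delta_mx i 0 *m (v - delta_mx 0 i) \in unitmx.
Proof.
move=> c0 v_i; set w := v - _; set e := delta_mx i 0.
have we : w *m e = (c - 1)%:P%:M.
  rewrite mulmxBl -colE mul_delta_mx; apply/matrixP=> a b.
  by rewrite !ord1 !mxE v_i !eqxx rmorphB.
suff /mulmx1_unit [] :
  (1%:M + e *m w) *m (1%:M - c^-1%:P *: (e *m w)) = 1%:M by [].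
rewrite mulmxBr mulmx1 -scalemxAr mulmxDl mul1mx mulmxA -(mulmxA e w) we.
rewrite mul_mx_scalar -scalemxAl -[X in c^-1%:P *: (X + _)]scale1r -scalerDl.
have -> : 1 + (c - 1)%:P = c%:P by rewrite rmorphB /= addrC subrK.
by rewrite scalerA -rmorphM mulVf // scale1r addrK.
Qed.

(** Row reduction over F[x].  If the matrix of leading coefficients has a left
    kernel vector u, then the combination of the rows with coefficients
    u_l x^(rho_i - rho_l), where rho_i is maximal among the rows that occur in u,
    cancels the terms of degree rho_i, and can replace row i.  This lowers the
    sum of the degree bounds rho, so it stops; rho_i > 0 since otherwise the
    combination would vanish, against det M != 0. *)
Lemma row_reduction (F : fieldType) n (M : 'M[{poly F}]_n) :
  \det M != 0 ->
  exists P (rho : 'I_n -> nat),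
    [/\ P \in unitmx,
        forall i j, (size ((P *m M) i j) <= (rho i).+1)%N &
        (\matrix_(i, j) ((P *m M) i j)`_(rho i)) \in unitmx].
Proof.
pose bounded (M : 'M[{poly F}]_n) (rho : 'I_n -> nat) :=
  forall i j, (size (M i j) <= (rho i).+1)%N.
suff main s : forall M rho, bounded M rho -> (\sum_i rho i < s)%N ->
  \det M != 0 -> exists P (rho : 'I_n -> nat),
    [/\ P \in unitmx, bounded (P *m M) rho &
        (\matrix_(i, j) ((P *m M) i j)`_(rho i)) \in unitmx].
  apply: (main _ M (fun i => \max_j size (M i j))%N _ (leqnn _)) => i j.
  by rewrite leqW // (leq_bigmax (F := fun j => size (M i j))).
elim: s => [|s IHs] {}M rho M_rho // lt_s detM.
have [L_unit|] := boolP ((\matrix_(i, j) (M i j)`_(rho i)) \in unitmx).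
  by exists 1%:M, rho; rewrite unitmx1 mul1mx.
rewrite unitmxE unitfE negbK => /det0P [u u0 uL0].
have [i0 ui0] : exists i, u 0 i != 0 by apply/rV0Pn.
have [i ui le_rho] : exists2 i, u 0 i != 0 &
    forall l, u 0 l != 0 -> (rho l <= rho i)%N.
  case: (@arg_maxnP _ _ (fun l => u 0 l != 0) rho ui0) => i ui le_rho.
  by exists i.
pose v : 'rV[{poly F}]_n := \row_l (u 0 l *: 'X^(rho i - rho l)).
have v_i : v 0 i = (u 0 i)%:P by rewrite mxE subnn expr0 alg_polyC.
have size_vM j : (size ((v *m M) 0%R j) <= rho i)%N.
  apply/leq_sizeP => m le_m; rewrite mxE coef_sum.
  have [->|neq_m] := eqVneq m (rho i).
    transitivity ((u *m \matrix_(l, j) (M l j)`_(rho l)) 0 j); last first.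
      by rewrite uL0 mxE.
    rewrite mxE; apply: eq_bigr => l _; rewrite !mxE -scalerAl coefZ coefXnM.
    have [->|ul] := eqVneq (u 0 l) 0; first by rewrite !mul0r.
    by rewrite ltnNge leq_subr /= subKn ?le_rho.
  rewrite big1 // => l _; rewrite mxE -scalerAl coefZ coefXnM.
  have [->|ul] := eqVneq (u 0 l) 0; first by rewrite mul0r.
  case: ifP => _; first by rewrite mulr0.
  rewrite nth_default ?mulr0 // (leq_trans (M_rho l j)) //.
  by have := le_rho l ul; lia.
set T := 1%:M + delta_mx i 0 *m (v - delta_mx 0 i).
have T_unit : T \in unitmx by apply: unitmx_replace_row ui v_i.
have TM a j : (T *m M) a j = if a == i then (v *m M) 0 j else M a j.
  rewrite mulmxDl mul1mx -mulmxA mulmxBl -rowE mxE [X in _ + X]mxE big_ord1 !mxE.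
  by case: eqP => [->|_]; rewrite ?mul1r ?mul0r ?addr0 // addrC subrK.
have rho_i_gt0 : (0 < rho i)%N.
  rewrite lt0n; apply: contra detM => /eqP rho_i0; apply/det0P; exists v.
    by apply: contraNneq ui => v0; rewrite -polyC_eq0 -v_i v0 mxE.
  apply/rowP=> j; rewrite [RHS]mxE; apply/eqP; rewrite -size_poly_leq0.
  by have := size_vM j; rewrite rho_i0.
pose rho' a := if a == i then (rho i).-1 else rho a.
have [a j||| P [rho'' [P_unit PTM_rho'' L_unit]]] := IHs (T *m M) rho'.
- by rewrite TM /rho'; case: eqP => _; rewrite ?prednK.
- rewrite -ltnS; apply: leq_trans lt_s.
  rewrite ltnS (bigD1 i) //= [X in (_ < X)%N](bigD1 i) //= /rho' eqxx.
  rewrite -addSn prednK //; rewrite leq_add2l leq_sum // => a ai.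
  by rewrite (negPf ai).
- rewrite det_mulmx mulf_neq0 //; move: T_unit; rewrite unitmxE.
  by apply: contraTneq => ->; rewrite unitr0.
by exists (P *m T), rho''; rewrite -mulmxA unitmx_mul P_unit T_unit.
Qed.

(** * Splitting of vector bundles *)

(** The theorem of Birkhoff and Grothendieck.  Clear denominators, A = x^N g,
    and row reduce A over k[x] to P A, whose row i has degree at most rho_i.
    Then x^-rho_i times row i is polynomial in 1/x, which gives Q and
    r_i = rho_i - N.  The value of Q at x = infinity is the matrix of leading
    coefficients, so det Q does not vanish there; being a monomial, as det P
    and det g are, it is a constant. *)
Theorem splitting (k : closedFieldType) n (E : vbundle k n) :
  exists (P Q : 'M[{poly k}]_n) (r : 'I_n -> int),
    [/\ P \in unitmx, Q \in unitmx,
        map_mx (@chart0 k) P *m trans E =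
          diag_mx (\row_i chart0 'X ^ r i) *m map_mx (@chart1 k) Q &
        \sum_i r i = - degree E].
Proof.
have X0 := chart0X_neq0 k.
have [N [A AE]] := mxlaurentP (@trans_laurent _ _ E).
have [c c0 detE] := det_trans E.
have detA : \det A != 0.
  by rewrite -chart0_eq0 -det_map_mx AE detZ mulf_neq0 ?expf_neq0 ?det_trans_neq0.
have [P [rho [P_unit PA_rho L_unit]]] := row_reduction detA.
pose Q := \matrix_(i, j) rev_poly (rho i) ((P *m A) i j).
pose r i := (rho i)%:Z - N%:Z.
have PAE : map_mx (@chart0 k) (P *m A) =
    chart0 'X ^+ N *: (map_mx (@chart0 k) P *m trans E).
  by rewrite map_mxM AE -scalemxAr.
have split_eq : map_mx (@chart0 k) P *m trans E =
    diag_mx (\row_i chart0 'X ^ r i) *m map_mx (@chart1 k) Q.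
  apply/matrixP=> i j; apply: (mulfI (expf_neq0 N X0)).
  transitivity (chart0 ((P *m A) i j)).
    by move/matrixP: PAE => /(_ i j); rewrite [LHS]mxE [RHS]mxE => ->.
  have Q_ij : map_mx (@chart1 k) Q i j = chart1 (rev_poly (rho i) ((P *m A) i j)).
    by rewrite 2!mxE.
  have r_i : (\row_i chart0 'X ^ r i) 0 i = chart0 ('X : {poly k}) ^ r i.
    by rewrite mxE.
  rewrite mul_diag_mx [in RHS]mxE r_i Q_ij.
  rewrite chart1_rev // /r expfzDr // -exprnN.
  rewrite mulrA [chart0 _ ^+ N * _]mulrCA mulfV ?expf_neq0 // mulr1.
  by rewrite mulrCA mulfV ?expf_neq0 // mulr1.
have [cP cP0 detP] : exists2 cP : k, cP != 0 & \det P = cP%:P.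
  exact/unitmx_polyP.
pose s := \sum_i r i.
have detQ : chart1 (\det Q) = chart0 (cP * c)%:P * chart0 'X ^ (- degree E - s).
  have := congr1 determinant split_eq.
  rewrite det_mulmx [in RHS]det_mulmx !det_map_mx detE detP det_diag /=.
  have -> : \prod_i (\row_i chart0 ('X : {poly k}) ^ r i) 0 i = chart0 'X ^ s.
    rewrite /s; elim/big_rec2: _ => // i x y _ ->.
    by rewrite mxE [in RHS]expfzDr.
  have -> : chart0 ('X : {poly k}) ^ (- degree E) =
            chart0 'X ^ s * chart0 'X ^ (- degree E - s).
    by rewrite -expfzDr // addrC subrK.
  by rewrite mulrA mulrCA polyCM rmorphM => /(mulfI (expfz_neq0 s X0)).
have Q0 : (\det Q).[0] != 0.
  have := L_unit; rewrite unitmxE unitfE.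
  rewrite -[_.[0]]/(horner_eval 0 (\det Q)) -det_map_mx.
  congr (_ != _); congr determinant; apply/matrixP=> i j.
  rewrite [LHS]mxE [RHS]mxE [Q _ _]mxE.
  by rewrite /= /horner_eval horner_coef0 coef_poly subn0.
have cc0 : (cP * c)%:P != 0 by rewrite polyC_eq0 mulf_neq0.
have s_eq : - degree E - s = 0.
  have detQ0 : \det Q != 0 by apply: contraNneq Q0 => ->; rewrite horner0.
  have := ord_inf_chart1 detQ0.
  rewrite detQ ord_infM ?chart0_eq0 ?(expfz_neq0 _ X0) //.
  rewrite (ord_inf_chart0 cc0) size_polyC -polyC_eq0 cc0 ord_infXz subrr add0r.
  rewrite oppr_ge0; move: detQ.
  case: (- degree E - s) => [m|m]; first by case: m.
  rewrite NegzE -exprnN -exprVn -chart1X -chart1C -rmorphXn -rmorphM.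
  move=> /chart1_inj eqQ.
  by move: Q0; rewrite eqQ hornerM hornerXn expr0n mulr0 eqxx.
exists P, Q, r; split=> //.
  apply/unitmx_polyP; exists (cP * c); first by rewrite -polyC_eq0.
  by apply: chart1_inj; rewrite detQ s_eq expr0z mulr1 chart1C.
by apply/eqP; rewrite eq_sym -subr_eq0; apply/eqP.
Qed.

Lemma size_H0_split (k : closedFieldType) n (E : vbundle k n) P Q
    (r : 'I_n -> int) (s : 'rV[{poly k}]_n) j :
  P \in unitmx -> Q \in unitmx ->
  map_mx (@chart0 k) P *m E =
    diag_mx (\row_i chart0 'X ^ r i) *m map_mx (@chart1 k) Q ->
  H0 E s -> (s *m invmx P) 0 j != 0 ->
  (size ((s *m invmx P) 0%R j))%:Z <= 1 - r j.
Proof.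
move=> P_unit Q_unit split_eq [s1 s1E].
apply: (@size_le_of_chart1 _ _ ((s1 *m invmx Q) 0 j)).
have : map_mx (@chart0 k) (s *m invmx P) *m diag_mx (\row_i chart0 'X ^ r i) =
    map_mx (@chart1 k) (s1 *m invmx Q).
  rewrite [RHS]map_mxM s1E -[s in RHS](mulmxKV P_unit) [in RHS]map_mxM /=.
  rewrite -[X in _ = X *m _]mulmxA split_eq -!mulmxA -map_mxM.
  by rewrite mulmxV // map_mx1 mulmx1.
move/rowP => /(_ j); rewrite mul_mx_diag [LHS]mxE [RHS]mxE => <-.
by rewrite [in RHS]mxE [X in _ = _ * X]mxE.
Qed.

(** * Direct sums of line bundles *)

Lemma is_laurentXz (k : closedFieldType) (z : int) :
  is_laurent (chart0 ('X : {poly k}) ^ z).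
Proof.
case: z => m; first by exists 'X^m, 0%N; rewrite expr0 divr1 rmorphXn.
by exists 1, m.+1; rewrite rmorph1 mul1r NegzE exprnN.
Qed.

Lemma is_laurent_diag (k : closedFieldType) n (r : 'I_n -> int) i j :
  is_laurent (diag_mx (\row_i chart0 ('X : {poly k}) ^ r i) i j).
Proof.
rewrite !mxE; case: (i == j); first exact: is_laurentXz.
by exists 0, 0%N; rewrite rmorph0 mul0r.
Qed.

Lemma mul_diag_expz (k : closedFieldType) n (r : 'I_n -> int) :
  diag_mx (\row_i chart0 ('X : {poly k}) ^ r i) *m
  diag_mx (\row_i chart0 'X ^ (- r i)) = 1%:M.
Proof.
rewrite mulmx_diag -diag_const_mx; congr diag_mx; apply/rowP => i.
by rewrite !mxE -expfzDr ?chart0X_neq0 // subrr expr0z.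
Qed.

Section DiagBundle.
Variables (k : closedFieldType) (n : nat) (r : 'I_n -> int).
Let D : 'M[ratfun k]_n := diag_mx (\row_i chart0 'X ^ r i).

Fact diag_trans_unit : D \in unitmx.
Proof. exact: proj1 (mulmx1_unit (mul_diag_expz k r)). Qed.

Fact diag_transV_laurent i j : is_laurent (invmx D i j).
Proof.
rewrite -[invmx _]mulmx1 -(mul_diag_expz k r) mulKmx ?diag_trans_unit //.
exact: is_laurent_diag.
Qed.

(** Since O(d) has transition function x^-d, the summands are the O(- r i). *)
Definition diag_bundle : vbundle k n :=
  VBundle diag_trans_unit (@is_laurent_diag k n r) diag_transV_laurent.

Lemma degree_diag_bundle : degree diag_bundle = - \sum_i r i.
Proof.
rewrite /degree /= det_diag -(ord_infXz k); congr ord_inf.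
elim/big_rec2: _ => // i x y _ ->.
by rewrite mxE [in RHS]expfzDr ?chart0X_neq0.
Qed.

End DiagBundle.

Lemma H0_diag_bundle (k : closedFieldType) n (N : 'I_n -> nat)
    (s : 'rV[{poly k}]_n) :
  (forall j, (size (s 0%R j) <= (N j).+1)%N) ->
  H0 (diag_bundle k (fun j => - (N j)%:Z)) s.
Proof.
move=> s_size; exists (\row_j rev_poly (N j) (s 0 j)); apply/rowP=> j.
rewrite mul_mx_diag [LHS]mxE [X in chart1 X]mxE chart1_rev // [RHS]mxE.
by rewrite [X in _ = X * _]mxE [X in _ = _ * X]mxE -exprnN.
Qed.

(** * Subbundles *)

Lemma degree_subbundle_full (k : closedFieldType) n (E' E : vbundle k n) A0 A1 :
  is_morphism E' E A0 A1 -> A0 \in unitmx -> A1 \in unitmx ->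
  degree E' = degree E.
Proof.
move=> /(congr1 determinant); rewrite !det_mulmx !det_map_mx /=.
move=> eq_det /unitmx_polyP [b0 b0n0 A0E] /unitmx_polyP [b1 b1n0 A1E].
have b_n0 (b : k) : b != 0 -> b%:P != 0 by rewrite polyC_eq0.
have ord_b (b : k) : b != 0 -> ord_inf (chart0 b%:P) = 0.
  by move=> bn0; rewrite ord_inf_chart0 ?b_n0 // size_polyC bn0 subrr.
move: eq_det; rewrite A0E A1E chart1C => /(congr1 (@ord_inf k)).
rewrite !ord_infM ?det_trans_neq0 ?chart0_eq0 ?b_n0 // !ord_b // add0r addr0.
by rewrite /degree => ->.
Qed.

(** A map from a line bundle L to O(- r j) is a section of
    O(- r j - degree L). *)
Lemma size_sub_line (k : closedFieldType) n (L : vbundle k 1) (r : 'I_n -> int)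
    (A0 A1 : 'M[{poly k}]_(1, n)) j :
  is_morphism L (diag_bundle k r) A0 A1 -> A0 0 j != 0 ->
  (size (A0 0%R j))%:Z <= 1 - r j - degree L.
Proof.
move=> /rowP /(_ j).
rewrite mul_mx_diag [LHS]mxE [X in X * _ = _]mxE [X in _ * X = _]mxE.
rewrite [RHS]mxE big_ord1 [X in _ = _ * X]mxE.
have [b b0] := det_trans L; rewrite det_mx11 => -> A_eq A0j.
rewrite -addrA -opprD; apply: (@size_le_of_chart1 _ _ (b%:P * A1 0 j)) => //.
have X0 := chart0X_neq0 k.
rewrite expfzDr // mulrA A_eq rmorphM /= chart1C.
by rewrite mulrAC -[X in X * _]mulrA -expfzDr // addNr expr0z mulr1.
Qed.

(** If v is a nonzero constant vector supported on summands of E of the same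
    degree -e, then v P and v Q embed O(-e) as a subbundle of E.  It makes a
    coherent subsystem with any subspace of V whose elements are multiples of
    v P: such a multiple is a section of E, and the multiplier can be read off
    along a summand in the support of v, so it is a section of O(-e). *)
Lemma line_subsystem_slope (k : closedFieldType) (R : realType) (alpha : R)
    n d m (X : coherent_system k n d m) P Q (r : 'I_n -> int)
    (v : 'rV[k]_n) (e : int) m' (F : 'M[{poly k}]_(m', 1)) :
  alpha_stable alpha X -> (1 < n)%N -> P \in unitmx -> Q \in unitmx ->
  map_mx (@chart0 k) P *m bundle X =
    diag_mx (\row_i chart0 'X ^ r i) *m map_mx (@chart1 k) Q ->
  v != 0 -> (forall i, v 0 i != 0 -> r i = e) ->
  injective (fun c : 'rV[k]_m' => map_mx polyC c *m F) ->
  (forall c : 'rV[k]_m',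
     sections X (map_mx polyC c *m F *m (map_mx polyC v *m P))) ->
  slope alpha 1 (- e) m' < slope alpha n d m.
Proof.
move=> X_stable n_gt1 P_unit Q_unit split_eq v0 v_e F_inj F_X.
have v_diag : map_mx (@chart0 k) (map_mx polyC v) *m
    diag_mx (\row_i chart0 'X ^ r i) =
    chart0 'X ^ e *: map_mx (@chart1 k) (map_mx polyC v).
  rewrite mul_mx_diag; apply/rowP=> i; rewrite !mxE chart1C.
  have [->|vi] := eqVneq (v 0 i) 0; first by rewrite !rmorph0 mul0r mulr0.
  by rewrite v_e // mulrC.
set A0 := map_mx polyC v *m P; set A1 := map_mx polyC v *m Q.
have A_split : map_mx (@chart0 k) A0 *m bundle X =
    chart0 'X ^ e *: map_mx (@chart1 k) A1.
  by rewrite map_mxM -mulmxA split_eq mulmxA v_diag -scalemxAl -map_mxM.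
pose L := diag_bundle k (fun _ : 'I_1 => e).
have L_trans p (B : 'M_(1, p)) : trans L *m B = chart0 'X ^ e *: B.
  by apply/matrixP=> i j; rewrite mul_diag_mx !mxE.
have L_trans_r p (B : 'M_(p, 1)) : B *m trans L = chart0 'X ^ e *: B.
  by apply/matrixP=> i j; rewrite mul_mx_diag !mxE mulrC.
have L_H0 : range (fun c : 'rV[k]_m' => map_mx polyC c *m F) `<=` H0 L.
  move=> _ [c _ <-]; have [s1 s1E] := sections_H0 (F_X c).
  have [i vi] : exists i, v 0 i != 0 by apply/rV0Pn.
  have {}s1E : map_mx (@chart1 k) (s1 *m invmx Q) =
      map_mx (@chart0 k) (map_mx polyC c *m F) *m
      (chart0 'X ^ e *: map_mx (@chart1 k) (map_mx polyC v)).
    rewrite map_mxM s1E map_mxM /= -/A0 -[X in X *m _ = _]mulmxA A_split.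
    rewrite -mulmxA -scalemxAl /= -map_mxM; congr (_ *m (_ *: map_mx _ _)).
    by rewrite /A1 -mulmxA mulmxV // mulmx1.
  have {}s1E : chart1 ((s1 *m invmx Q) 0 i) =
      chart0 (v 0 i)%:P * (chart0 'X ^ e * chart0 ((map_mx polyC c *m F) 0 0)).
    move/rowP: s1E => /(_ i); rewrite [LHS]mxE => ->.
    rewrite -scalemxAr [LHS]mxE mxE big_ord1 [X in _ * (_ * X) = _]mxE.
    rewrite [X in _ * (X * _) = _]mxE [X in chart1 X]mxE.
    by rewrite chart1C mulrA [LHS]mulrC.
  exists (\row__ ((v 0 i)^-1%:P * (s1 *m invmx Q) 0 i)).
  apply/rowP=> j.
  rewrite L_trans_r ord1 [LHS]mxE [X in chart1 X]mxE rmorphM /= s1E.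
  rewrite chart1C mulrA -!rmorphM mulVf // rmorph1 mul1r.
  by rewrite [RHS]mxE [X in _ = _ * X]mxE.
have L_degree : degree L = - e by rewrite degree_diag_bundle big_ord1.
have L_dim :
    is_subspace_of_dim m' (range (fun c : 'rV[k]_m' => map_mx polyC c *m F)).
  by exists F.
have row_free_vM (M : 'M[{poly k}]_n) (c : k) : M \in unitmx ->
    row_free (map_mx (horner_eval c) (map_mx polyC v *m M)).
  move=> M_unit; rewrite map_mxM /=.
  have -> : map_mx (horner_eval c) (map_mx polyC v) = v.
    by apply/matrixP=> i j; rewrite !mxE /horner_eval hornerC.
  rewrite /row_free mxrankMfree ?row_free_unit ?unitmx_horner //.
  by rewrite rank_rV v0.
apply: (X_stable _ _ _ (CoherentSystem L_degree L_H0 L_dim) A0 A1).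
  split=> //=.
    split=> [|c|c]; [|exact: row_free_vM|exact: row_free_vM].
    by rewrite /is_morphism /= A_split L_trans.
  by move=> _ [_ [c _ <-] <-]; apply: F_X.
case=> A0_surj _ _.
have delta_A0 i : exists c : 'M[{poly k}]_1, c *m A0 = delta_mx 0 i.
  have : [set: 'rV[{poly k}]_n] (delta_mx 0 i) by [].
  by rewrite -A0_surj => -[c _ cA0]; exists c.
have [C CA0] := fin_all_exists delta_A0.
suff : (\matrix_i C i) *m A0 = 1%:M.
  by move/mulmx1_min; rewrite leqNgt n_gt1.
by apply/row_matrixP=> i; rewrite row_mul rowK CA0 row1.
Qed.

(** * Destabilising line subbundles *)

Lemma slope2 (R : realType) (alpha : R) (d : int) :
  slope alpha 2 d 2 = d%:~R / 2 + alpha.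
Proof. by rewrite /slope divff ?pnatr_eq0 // mulr1. Qed.

Section Destabilise.
Variables (k : closedFieldType) (R : realType) (alpha : R) (d : int).
Variable X : coherent_system k 2 d 2.
Hypothesis X_stable : alpha_stable alpha X.
Variables (P Q : 'M[{poly k}]_2) (r : 'I_2 -> int).
Hypotheses (P_unit : P \in unitmx) (Q_unit : Q \in unitmx).
Hypothesis split_eq : map_mx (@chart0 k) P *m bundle X =
    diag_mx (\row_i chart0 'X ^ r i) *m map_mx (@chart1 k) Q.

Lemma summand_degree_lt i : (- r i)%:~R < d%:~R / 2 + alpha.
Proof.
have := line_subsystem_slope (v := delta_mx 0 i) (e := r i) (m' := 0) (F := 0)
  X_stable isT P_unit Q_unit split_eq.
rewrite slope2 /slope mul0r mulr0 addr0 divr1; apply.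
- by apply/rV0Pn; exists i; rewrite mxE !eqxx oner_neq0.
- by move=> l; rewrite mxE eqxx /=; case: (l =P i) => [->//|_]; rewrite eqxx.
- by move=> c c' _; rewrite [c]thinmx0 [c']thinmx0.
move=> c; rewrite mulmx0 mul0mx; have [B _ ->] := sections_dim X.
by exists 0 => //; rewrite map_mx0 mul0mx.
Qed.

(** The section c B of V, written in the split frame, is f times the constant
    vector v, so it lies in the subbundle O(-e) directed by v. *)
Lemma section_line_degree_lt B (c v : 'rV[k]_2) (e : int) (f : {poly k}) :
  injective (fun c : 'rV[k]_2 => map_mx polyC c *m B) ->
  sections X = range (fun c : 'rV[k]_2 => map_mx polyC c *m B) ->
  c != 0 -> (forall i, v 0 i != 0 -> r i = e) ->
  map_mx polyC c *m (B *m invmx P) = f *: map_mx polyC v ->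
  2 * (- e) < d.
Proof.
move=> B_inj X_B c0 v_e cW.
have cB : map_mx polyC c *m B = f *: (map_mx polyC v *m P).
  by rewrite scalemxAl -cW -!mulmxA mulVmx ?mulmx1.
have cB0 : map_mx polyC c *m B != 0.
  apply: contraNneq c0 => cB0; apply/eqP/B_inj.
  by rewrite cB0 map_mx0 mul0mx.
have f0 : f != 0 by apply: contraNneq cB0 => f0; rewrite cB f0 scale0r.
have v0 : v != 0.
  by apply: contraNneq cB0 => v0; rewrite cB v0 map_mx0 mul0mx scaler0.
have : slope alpha 1 (- e) 1 < slope alpha 2 d 2.
  apply: (line_subsystem_slope (F := f%:M) X_stable isT P_unit Q_unit split_eq
            v0 v_e).
    move=> b b' /=; rewrite !mul_mx_scalar => /(scalemx_inj f0) /matrixP eqb.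
    by apply/matrixP=> i j; have := eqb i j; rewrite !mxE => /polyC_inj.
  move=> b; rewrite mul_mx_scalar -scalemxAl X_B; exists (b *m c) => //.
  by rewrite map_mxM -mulmxA cB -scalemxAr.
rewrite slope2 /slope !divr1 mulr1 ltrD2r.
by rewrite ltr_pdivlMr // -(ltr_int R) mulrC rmorphM.
Qed.

End Destabilise.

Lemma size2_polyE (F : nzRingType) (p : {poly F}) :
  (size p <= 2)%N -> p = (p`_0)%:P + p`_1 *: 'X.
Proof.
move=> sp; apply/polyP=> i; rewrite coefD coefC coefZ coefX.
case: i => [|[|i]] /=; rewrite ?mulr0 ?mulr1 ?addr0 ?add0r //.
by rewrite nth_default // (leq_trans sp).
Qed.

(** Two sections of O(1) + O(1) have a nontrivial combination that vanishes at a
    point, namely a zero of the determinant, and is therefore a linear form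
    times a constant vector.  The determinant is regarded as a form of degree 2:
    when it is constant in x, its zero is at infinity, where the value of the
    sections is given by the coefficients of x, and the linear form is 1. *)
Lemma linear_pencil_line (k : closedFieldType) (W : 'M[{poly k}]_2) :
  (forall i j, (size (W i j) <= 2)%N) ->
  exists (c v : 'rV[k]_2) (f : {poly k}),
    c != 0 /\ map_mx polyC c *m W = f *: map_mx polyC v.
Proof.
move=> W_size.
have size_cW (c : 'rV[k]_2) j : (size ((map_mx polyC c *m W) 0%R j) <= 2)%N.
  rewrite mxE; apply: (leq_trans (size_sum _ _ _)); apply/bigmax_leqP => i _.
  by rewrite mxE mul_polyC (leq_trans (size_scale_leq _ _)).
have [/eqP size1|/closed_rootP [z z_root]] := boolP (size (\det W) == 1%N).
  pose W1 := \matrix_(i, j) (W i j)`_1.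
  have /det0P [c c0 cW1] : \det W1 == 0.
    have : (\det W)`_2 = 0 by rewrite nth_default // size1.
    rewrite !det_mx2 coefB !coefM !big_ord_recl !big_ord0 /= !mxE.
    rewrite ![_`_2]nth_default ?W_size // !(mul0r, mulr0, add0r, addr0).
    by move=> ->.
  exists c, (\row_j ((map_mx polyC c *m W) 0 j)`_0), 1; split=> //.
  apply/rowP=> j; rewrite scale1r [RHS]mxE [X in X%:P]mxE.
  rewrite {1}[LHS]size2_polyE ?size_cW //.
  have -> : ((map_mx polyC c *m W) 0 j)`_1 = 0.
    transitivity ((c *m W1) 0 j); last by rewrite cW1 mxE.
    rewrite !mxE coef_sum; apply: eq_bigr => i _.
    by rewrite !mxE coefCM.
  by rewrite scale0r addr0.
have /det0P [c c0 cWz] : \det (map_mx (horner_eval z) W) == 0.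
  by rewrite det_map_mx.
exists c, (\row_j ((map_mx polyC c *m W) 0 j)`_1), ('X - z%:P); split=> //.
apply/rowP=> j; rewrite [RHS]mxE [in RHS]mxE [X in _ * X%:P]mxE.
set p := (map_mx polyC c *m W) 0 j.
have pE : p = (p`_0)%:P + p`_1 *: 'X by apply: size2_polyE; apply: size_cW.
have : ((p`_0)%:P + p`_1 *: 'X).[z] == 0.
  rewrite -pE; apply/eqP.
  transitivity ((c *m map_mx (horner_eval z) W) 0 j); last by rewrite cWz mxE.
  rewrite /p !mxE horner_sum; apply: eq_bigr => i _.
  by rewrite !mxE hornerCM.
rewrite hornerD hornerC hornerZ hornerX addr_eq0 => /eqP p0.
transitivity ((p`_0)%:P + p`_1 *: 'X); first exact: pE.
rewrite p0 -mul_polyC polyCN polyCM.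
by rewrite mulrBl addrC [_ * 'X]mulrC [z%:P * _]mulrC.
Qed.

Lemma order_indices (r : 'I_2 -> int) :
  exists i j : 'I_2, [/\ r i <= r j, \sum_l r l = r i + r j &
    forall l, l = i \/ l = j].
Proof.
have sum_r : \sum_l r l = r 0 + r 1.
  by rewrite !big_ord_recl big_ord0 addr0; congr (_ + r _); apply: val_inj.
have [le_r|/ltW le_r] := lerP (r 0) (r 1).
  by exists 0, 1; split=> //; apply: ord2P.
by exists 1, 0; split; rewrite 1?addrC // => l; case: (ord2P l); [right|left].
Qed.

Lemma stable_necessary (k : closedFieldType) (R : realType) (alpha : R)
    (d a t : int) (X : coherent_system k 2 d 2) :
  d = 2 * a - t -> 0 <= t < 2 -> alpha_stable alpha X ->
  2 < d /\ t%:~R / 2 < alpha.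
Proof.
move=> hd ht X_stable.
have [P [Q [r [P_unit Q_unit split_eq]]]] := splitting (bundle X).
rewrite bundle_degree => sum_r; have [i [j [le_r sum_ij ij]]] := order_indices r.
split; last first.
  have := summand_degree_lt X_stable P_unit Q_unit split_eq i.
  have : a%:~R <= (- r i)%:~R :> R by rewrite ler_int; lia.
  by rewrite hd rmorphB rmorphM /=; lra.
rewrite ltNge; apply/negP => d_le2.
have [B B_inj X_B] := sections_dim X.
have no_line := section_line_degree_lt X_stable P_unit Q_unit split_eq B_inj X_B.
have W_size (n : nat) l j' :
    1 - r j' <= n -> (size ((B *m invmx P) l j') <= n)%N.
  move=> le_n; have [->|W0] := eqVneq ((B *m invmx P) l j') 0.
    by rewrite size_poly0.
  rewrite -lez_nat; apply: le_trans le_n; move: W0.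
  have -> : (B *m invmx P) l j' = (row l B *m invmx P) 0 j'.
    by rewrite -row_mul [RHS]mxE.
  apply: (size_H0_split P_unit Q_unit split_eq).
  apply: sections_H0; rewrite X_B; exists (delta_mx 0 l) => //.
  by rewrite map_delta_mx -rowE.
move: (B *m invmx P) no_line W_size => W no_line W_size.
have [r_j_ge0|r_j_lt0] := lerP 0 (r j).
  (* Column j of W is constant; c kills it. *)
  pose w := \col_l (W l j)`_0.
  have [c c0 cw] := left_kernel w isT.
  suff : 2 * (- r i) < d by lia.
  pose f := (map_mx polyC c *m W) 0 i.
  apply: (no_line c (delta_mx 0 i) (r i) f c0).
    by move=> l; rewrite mxE eqxx /=; case: (l =P i) => [->//|_]; rewrite eqxx.
  apply/rowP => l; rewrite [RHS]mxE [in RHS]mxE [X in _ * X%:P]mxE eqxx /=.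
  have [->|ne_li] := eqVneq l i; first by rewrite mulr1.
  have {ne_li} -> : l = j.
    by case: (ij l) => // eq_li; rewrite eq_li eqxx in ne_li.
  rewrite mulr0; transitivity (((c *m w) 0 0)%:P); last by rewrite cw mxE.
  rewrite !mxE rmorph_sum; apply: eq_bigr => m _; rewrite !mxE rmorphM /=.
  by congr (_ * _); apply: size1_polyC; apply: W_size; lia.
(* r i <= r j < 0 and r i + r j = - d >= -2 force r i = r j = -1. *)
have [c [v [f [c0 cW]]]] : exists (c v : 'rV[k]_2) (f : {poly k}),
    c != 0 /\ map_mx polyC c *m W = f *: map_mx polyC v.
  apply: linear_pencil_line => l m.
  by apply: W_size; case: (ij m) => ->; lia.
suff : 2 * (- -1) < d :> int by lia.
apply: (no_line c v (-1) f c0 _ cW) => l _.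
by case: (ij l) => ->; lia.
Qed.

(** * The model: (1, x) and (x^n, 1) on O(n) + O(m) *)

Section Model.
Variables (k : closedFieldType) (n m : nat).
Hypotheses (n_gt1 : (1 < n)%N) (m_gt0 : (0 < m)%N).

Definition model_degrees (i : 'I_2) : nat := if i == 0 then n else m.
Definition model_bundle := diag_bundle k (fun i => - (model_degrees i)%:Z).
Definition model_frame : 'M[{poly k}]_2 :=
  \matrix_(i, j) if i == 0 then (if j == 0 then 1 else 'X)
                 else (if j == 0 then 'X^n else 1).
Definition model_sections :=
  range (fun c : 'rV[k]_2 => map_mx polyC c *m model_frame).

Lemma model_degree : degree model_bundle = (n + m)%N%:Z.
Proof.
rewrite degree_diag_bundle !big_ord_recl big_ord0 /model_degrees /=.
by rewrite PoszD; lia.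
Qed.

Lemma model_section0 (c : 'rV[k]_2) :
  (map_mx polyC c *m model_frame) 0 0 = (c 0 0)%:P + c 0 1 *: 'X^n.
Proof.
rewrite mxE !big_ord_recl big_ord0 !mxE /= mulr1 addr0 mul_polyC.
by congr (_ + c _ _ *: _); apply: val_inj.
Qed.

Lemma model_section1 (c : 'rV[k]_2) :
  (map_mx polyC c *m model_frame) 0 1 = (c 0 1)%:P + c 0 0 *: 'X.
Proof.
rewrite mxE !big_ord_recl big_ord0 !mxE /= mulr1 addr0 mul_polyC addrC.
by congr ((c _ _)%:P + _); apply: val_inj.
Qed.

Lemma det_model_frame : \det model_frame != 0.
Proof.
rewrite det_mx2 !mxE /= mulr1 -exprS -[1]opprK -opprD oppr_eq0 addrC.
by rewrite -size_poly_eq0 size_XnsubC.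
Qed.

Lemma model_frame_inj p (A B : 'M[{poly k}]_(p, 2)) :
  A *m model_frame = B *m model_frame -> A = B.
Proof.
move=> AB; apply/row_matrixP=> i; apply/eqP; rewrite -subr_eq0.
apply: contraNT det_model_frame => AB_i; apply/det0P.
by exists (row i A - row i B) => //; rewrite mulmxBl -!row_mul AB subrr.
Qed.

Lemma model_sections_dim : is_subspace_of_dim 2 model_sections.
Proof.
exists model_frame => // c c' /model_frame_inj /matrixP cc'.
by apply/matrixP=> i j; have := cc' i j; rewrite !mxE => /polyC_inj.
Qed.

Lemma model_sections_H0 : model_sections `<=` H0 model_bundle.
Proof.
move=> _ [c _ <-]; apply: H0_diag_bundle => j.
have size_term (b e : k) (p : {poly k}) N : (0 < N)%N -> (size p <= N.+1)%N ->
    (size (b%:P + e *: p)%R <= N.+1)%N.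
  move=> N0 sp; rewrite (leq_trans (size_polyD _ _)) // geq_max.
  by rewrite (leq_trans (size_polyC_leq1 _)) // (leq_trans (size_scale_leq _ _)).
case: (ord2P j) => ->.
  by rewrite model_section0 size_term ?size_polyXn // ltnW.
by rewrite model_section1 size_term ?size_polyX.
Qed.

Definition model : coherent_system k 2 (n + m)%N%:Z 2 :=
  CoherentSystem model_degree model_sections_H0 model_sections_dim.

(** The map V' -> V is a constant matrix C in the given bases; it is injective
    because E' -> E is. *)
Lemma model_subsystem_matrix n' d' m'
    (X' : coherent_system k n' d' m') A0 A1 :
  is_coherent_subsystem X' model A0 A1 ->
  exists B (C : 'M[k]_(m', 2)),
    [/\ sections X' = range (fun c : 'rV[k]_m' => map_mx polyC c *m B),
        map_mx polyC C *m model_frame = B *m A0 & row_free C].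
Proof.
move=> [_ [_ A0_free _] sub]; have [B B_inj X'B] := sections_dim X'.
have rowB i : exists c : 'rV[k]_2,
    map_mx polyC c *m model_frame = row i B *m A0.
  have /sub [c _ cE] : (mulmxr A0 @` sections X') (row i B *m A0).
    exists (row i B) => //; rewrite X'B; exists (delta_mx 0 i) => //.
    by rewrite map_delta_mx -rowE.
  by exists c.
have [C CE] := fin_all_exists rowB.
have CS : map_mx polyC (\matrix_i C i) *m model_frame = B *m A0.
  by apply/row_matrixP=> i; rewrite !row_mul -map_row rowK CE.
exists B, (\matrix_i C i); split=> //.
rewrite -kermx_eq0; apply: contraT => /rowV0Pn [c /sub_kermxP cC /eqP []].
apply: B_inj; rewrite map_mx0 mul0mx; apply: (fibrewise_free_inj A0_free).
by rewrite -mulmxA -CS mulmxA -map_mxM cC map_mx0 mul0mx.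
Qed.

Hypothesis le_mn : (m <= n)%N.

(** If the section c of V is f times the direction p of a line subbundle of
    degree e, then p_0 and p_1 have degrees at most n - e and m - e.  As p_1
    cannot vanish, e <= m, and 2e >= n + m would leave only e = n = m with p
    constant.  Then the components c_0 + c_1 x^n and c_1 + c_0 x of the section
    would be proportional, which fails because n > 1. *)
Lemma model_line_section_degree_lt (e : nat) (c : 'rV[k]_2) f
    (p : 'rV[{poly k}]_2) :
  c != 0 -> map_mx polyC c *m model_frame = f *: p ->
  (forall j, p 0 j != 0 -> (size (p 0%R j) <= model_degrees j + 1 - e)%N) ->
  (2 * e < n + m)%N.
Proof.
move=> c0 cp p_size; rewrite ltnNge; apply/negP => le_e.
have e0 : (c 0 0)%:P + c 0 1 *: 'X^n = f * p 0 0.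
  by rewrite -model_section0 cp mxE.
have e1 : (c 0 1)%:P + c 0 0 *: 'X = f * p 0 1.
  by rewrite -model_section1 cp mxE.
have c00_11 : (c 0 0 != 0) || (c 0 1 != 0).
  apply: contraNT c0; rewrite negb_or !negbK => /andP [/eqP c0 /eqP c1].
  by apply/eqP/rowP => j; rewrite mxE; case: (ord2P j) => ->.
have p1 : p 0 1 != 0.
  apply: contraTneq c00_11 => p1; move/polyP: e1; rewrite p1 mulr0 => e1.
  have := e1 0%N; have := e1 1%N.
  rewrite !coefD !coefC !coefZ !coefX ?coef0 /=.
  by rewrite !(mulr0, mulr1, addr0, add0r) => -> ->; rewrite eqxx.
have p0 : p 0 0 != 0.
  apply: contraTneq c00_11 => p0; move/polyP: e0; rewrite p0 mulr0 => e0.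
  have := e0 0%N; have := e0 n.
  rewrite !coefD !coefC !coefZ !coefXn ?coef0 eqxx.
  rewrite -!(eq_sym n) (gtn_eqF (ltnW n_gt1)) /=.
  by rewrite !(mulr0, mulr1, addr0, add0r) => -> ->; rewrite eqxx.
have := p_size _ p1; have := p_size _ p0; rewrite /model_degrees /= => s0 s1.
have lt_em : (0 < m + 1 - e)%N by apply: leq_trans s1; rewrite size_poly_gt0.
have [/size1_polyC p0C /size1_polyC p1C] :
    (size (p 0%R 0%R) <= 1)%N /\ (size (p 0%R 1%R) <= 1)%N.
  by split; [apply: leq_trans s0 _|apply: leq_trans s1 _]; lia.
have eq01 : (p 0 1)`_0 *: ((c 0 0)%:P + c 0 1 *: 'X^n) =
            (p 0 0)`_0 *: ((c 0 1)%:P + c 0 0 *: 'X).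
  rewrite e0 e1 -!mul_polyC -p0C -p1C.
  by rewrite mulrCA [RHS]mulrCA [p 0 1 * _]mulrC.
have p1n0 : (p 0 1)`_0 != 0 by rewrite -polyC_eq0 -p1C.
have c1 : c 0 1 = 0.
  move/polyP: eq01 => /(_ n).
  rewrite !coefZ !coefD !coefC !coefZ coefX coefXn eqxx (gtn_eqF n_gt1).
  rewrite (gtn_eqF (ltnW n_gt1)) !(mulr0, mulr1, addr0, add0r).
  by move/eqP; rewrite mulf_eq0 (negPf p1n0) => /eqP.
move/polyP: eq01 => /(_ 0%N); rewrite c1 !scale0r addr0 polyC0 add0r.
rewrite !coefZ coefC coefX /= !mulr0.
move/eqP; rewrite mulf_eq0 (negPf p1n0) /= => /eqP c00.
by rewrite c00 c1 eqxx in c00_11.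
Qed.

Variables (R : realType) (alpha : R).
Hypothesis alpha_gt : (n - m)%N%:R / 2 < alpha.

Lemma model_line_slope d' m' (X' : coherent_system k 1 d' m') A0 A1 :
  is_coherent_subsystem X' model A0 A1 ->
  slope alpha 1 d' m' < slope alpha 2 (n + m)%N 2.
Proof.
move=> subX; have [B [C [X'B CS C_free]]] := model_subsystem_matrix subX.
have [_ [A_morph A0_free _] _] := subX; rewrite slope2.
have A0_size j : A0 0 j != 0 ->
    (size (A0 0%R j))%:Z <= 1 + (model_degrees j)%:Z - d'.
  by move=> A0j; have := size_sub_line A_morph A0j; rewrite opprK bundle_degree.
have le_d'n : d' <= n%:Z.
  have /rV0Pn [j A0j] : A0 != 0.
    by apply: contraTneq (A0_free 0) => ->; rewrite map_mx0 /row_free mxrank0.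
  have := A0_size j A0j.
  have : (0 < size (A0 0%R j))%N by rewrite size_poly_gt0.
  have : (model_degrees j <= n)%N by rewrite /model_degrees; case: ifP => _; lia.
  by move: (size _) (model_degrees _) => x y; lia.
have [m'0|[m'1|m'2]] : m' = 0%N \/ m' = 1%N \/ m' = 2.
- by have := rank_leq_col C; rewrite (eqP C_free); lia.
- rewrite /slope divr1 m'0 mul0r mulr0 addr0.
  move: le_d'n; rewrite -(ler_int R) => /le_lt_trans; apply.
  by move: alpha_gt; rewrite natrB ?natrD; [lra|lia].
- subst m'; rewrite /slope !divr1 mulr1 ltrD2r.
  suff : 2 * d' < (n + m)%N%:Z by rewrite -(ltr_int R) rmorphM /=; lra.
  have [d'_ge0|] := lerP 0 d'; last by lia.
  have [e d'e] : exists e : nat, d' = e by exists `|d'|%N; lia.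
  suff : (2 * e < n + m)%N by lia.
  apply: (@model_line_section_degree_lt e C (B 0 0) A0).
  + by apply: contraTneq C_free => ->; rewrite /row_free mxrank0.
  + rewrite CS; apply/rowP=> j; rewrite mxE big_ord1 [RHS]mxE.
    by congr (B _ _ * A0 _ _); apply: val_inj.
  move=> j A0j; have := A0_size j A0j.
  by move: (size _) (model_degrees _) => x y; lia.
(* C is invertible, so B A0 has the rank 2 of the frame, while B is a column. *)
subst m'; have := congr1 determinant CS.
rewrite det_mulmx det_map_mx /= [RHS]det_mx2 !mxE !big_ord1.
have -> : B 0 ord0 * A0 ord0 1 * (B 1 ord0 * A0 ord0 0) =
          B 0 ord0 * A0 ord0 0 * (B 1 ord0 * A0 ord0 1).
  by rewrite mulrACA [A0 _ _ * _]mulrC mulrACA.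
rewrite subrr => /eqP.
rewrite mulf_eq0 (negPf det_model_frame) orbF polyC_eq0 -[_ == 0]negbK.
by move: C_free; rewrite row_free_unit unitmxE unitfE => ->.
Qed.

Lemma model_full_slope d' m' (X' : coherent_system k 2 d' m') A0 A1 :
  is_coherent_subsystem X' model A0 A1 -> ~ is_whole X' model A0 A1 ->
  slope alpha 2 d' m' < slope alpha 2 (n + m)%N 2.
Proof.
move=> subX not_whole.
have [B [C [X'B CS C_free]]] := model_subsystem_matrix subX.
have [_ [A_morph A0_free A1_free] X'_sub] := subX; rewrite slope2.
have alpha_gt0 : 0 < alpha.
  by apply: le_lt_trans alpha_gt; rewrite divr_ge0 ?ler0n.
have A0_unit := fibrewise_free_unitmx A0_free.
have A1_unit := fibrewise_free_unitmx A1_free.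
have d'E : d' = (n + m)%N.
  by have := degree_subbundle_full A_morph A0_unit A1_unit; rewrite !bundle_degree.
rewrite /slope d'E ltrD2l gtr_pMr // ltr_pdivrMr // mul1r ltr_nat.
rewrite ltn_neqAle -{2}(eqP C_free) rank_leq_col andbT; apply/eqP => m'2.
case: not_whole; split.
- by apply/seteqP; split=> // s _; exists (s *m invmx A0) => //=; rewrite mulmxKV.
- by apply/seteqP; split=> // s _; exists (s *m invmx A1) => //=; rewrite mulmxKV.
apply/seteqP; split=> //.
subst m'; have C_unit : C \in unitmx by rewrite -row_free_unit.
move=> _ [c _ <-]; exists (map_mx polyC (c *m invmx C) *m B).
  by rewrite X'B; exists (c *m invmx C).
by rewrite /= -mulmxA -CS mulmxA -map_mxM mulmxKV.
Qed.

Lemma model_stable : alpha_stable alpha model.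
Proof.
move=> n' d' m' X' A0 A1 subX not_whole.
have [n'_gt0 [_ A0_free _] _] := subX.
have [n'1|n'2] : n' = 1%N \/ n' = 2.
- by have := rank_leq_col (map_mx (horner_eval 0) A0); rewrite (eqP (A0_free 0)); lia.
- by subst n'; apply: model_line_slope subX.
by subst n'; apply: model_full_slope subX not_whole.
Qed.

End Model.

(** * Nonemptiness of the moduli space *)

Unset Implicit Arguments.

Theorem proposition5p6 (k : closedFieldType) (R : realType)
    (d : int) (alpha : R) (a t : int) (hd : d = 2 * a - t) (ht : 0 <= t < 2) :
  moduli k alpha 2 d 2 !=set0 <-> 2 < d /\ t%:~R / 2 < alpha.
Proof.
split=> [[_ [X X_stable _]]|[d_gt2 alpha_gt]].
  exact: (stable_necessary hd ht X_stable).
have [n an] : exists n : nat, a = n by exists `|a|%N; lia.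
have [m atm] : exists m : nat, a - t = m by exists `|a - t|%N; lia.
have d_nm : d = (n + m)%N by lia.
have n_gt1 : (1 < n)%N by lia.
have m_gt0 : (0 < m)%N by lia.
rewrite d_nm; pose X := model k n_gt1 m_gt0.
exists [set Y | isomorphic X Y]; exists X => //.
apply: model_stable; first lia.
have -> // : (n - m)%N%:R = t%:~R :> R.
by rewrite -[LHS]/((n - m)%N%:Z%:~R); congr _%:~R; lia.
Qed.
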